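(* Let $\mathcal{H}$ be a complex Hilbert space with $\dim \mathcal{H} \geqslant 2$, let $a, b \in \mathcal{H}$ and let $q \in [0,1]$. Then $$\omega_q(a\otimes b)=\frac{\|a\| \, \|b\|+q\,|\langle a,b\rangle|}{2}+\frac{\sqrt{1-q^2}}{2} \, \sqrt{\|a\|^2\|b\|^2-|\langle a,b\rangle|^2}.$$
   Context: The inner product $\langle\cdot,\cdot\rangle$ is linear in the first argument and conjugate-linear in the second. For $a,b\in\mathcal{H}$, $a\otimes b$ is the bounded linear operator on $\mathcal{H}$ given by $(a\otimes b)x=\langle x,a\rangle\, b$. For a bounded linear operator $A$ on $\mathcal{H}$ and $q\in[0,1]$, the $q$-numerical range is $\mathcal{W}_q(A)=\{\langle Ax,y\rangle : x,y\in\mathcal{H},\ \|x\|=\|y\|=1,\ \langle x,y\rangle=q\}$ and the $q$-numerical radius is $\omega_q(A)=\sup_{w\in\mathcal{W}_q(A)}|w|$. *)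

(* Defs.v *)
From HB Require Import structures.
From mathcomp Require Import all_boot all_order all_algebra.
From mathcomp Require Import complex.
From mathcomp Require Import all_classical all_reals.
From mathcomp Require Import ereal topology normedtype.
From mathcomp Require Import ring.

Set Implicit Arguments.
Unset Strict Implicit.
Unset Printing Implicit Defensive.

Import Order.TTheory GRing.Theory Num.Theory.
Import numFieldNormedType.Exports.

Local Open Scope classical_set_scope.
Local Open Scope ring_scope.
Local Open Scope complex_scope.

(* A {dot H for Num.conj} form is linear in its first argument,
   conjugate-linear in its second one, Hermitian and positive definite. *)
HB.mixin Record CompleteNormedModule_isHilbert (R : realType) H
    of CompleteNormedModule R[i] H := {
  inner : {dot H for @Num.conj R[i]} ;
  inner_normE : forall x : H, inner x x = `|x| ^+ 2
}.

#[short(type="hilbertType")]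
HB.structure Definition Hilbert (R : realType) :=
  {H of CompleteNormedModule R[i] H & CompleteNormedModule_isHilbert R H}.

Notation "''[' x , y ]" := (inner x y) (format "''[' x ,  y ]") : ring_scope.

(* Over the scalars R[i], the library's norms take their values in R[i], where
   they are nonnegative reals; this is the corresponding element of R. *)
Definition rnorm (R : realType) (V : normedZmodType R[i]) (x : V) : R :=
  complex.Re `|x|.

Definition lin_indep (K : fieldType) (V : lmodType K) n (e : 'I_n -> V) : Prop :=
  forall c : 'I_n -> K, \sum_(i < n) c i *: e i = 0 -> forall i, c i = 0.

(* dim V >= n; V may be infinite-dimensional. *)
Definition dim_geq (K : fieldType) (V : lmodType K) (n : nat) : Prop :=
  exists e : 'I_n -> V, lin_indep e.

Section Operators.
Variables (R : realType) (H : hilbertType R).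
Implicit Types (a b x y : H) (q : R).

Record bounded_operator := BoundedOperator {
  operator :> {linear H -> H} ;
  operator_bounded : exists M : R, forall x, `|operator x| <= M%:C * `|x|
}.

Lemma cauchy_schwarz x a : `|'[x, a]| <= `|x| * `|a|.
Proof.
have [->|a0] := eqVneq a 0; first by rewrite linear0r !normr0 mulr0.
have na0 : 0 < `|a| by rewrite normr_gt0.
rewrite -(@ler_pXn2r _ 2) ?nnegrE ?mulr_ge0// exprMn.
rewrite -ler_pdivrMr ?exprn_gt0// -subr_ge0.
set t := '[x, a] / `|a| ^+ 2.
suff -> : `|x| ^+ 2 - `|'[x, a]| ^+ 2 / `|a| ^+ 2 = `|x - t *: a| ^+ 2.
  by rewrite exprn_ge0.
rewrite -(inner_normE (x - _)) linearBl/= !linearBr/= !linearZl_LR/=.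
rewrite !linearZr_LR/= !inner_normE.
have -> : '[a, x] = Num.conj '[x, a] by rewrite hermC/= mul1r.
rewrite normCK /t rmorphM/= rmorphV ?unitfE ?expf_neq0 ?gt_eqF//.
rewrite rmorphXn/= (conj_Creal (ger0_real (ltW na0))).
move: '[x, a] (Num.conj '[x, a]) (`|x|) (`|a|) na0 => u v X Y Y0.
by have Yn0 : Y != 0 by [rewrite gt_eqF]; field.
Qed.

Definition otimes_fun a b x : H := '[x, a] *: b.

Lemma otimes_fun_linear a b : linear (otimes_fun a b).
Proof.
by move=> k x y; rewrite /otimes_fun linearPl scalerDl scalerA.
Qed.

HB.instance Definition _ a b :=
  GRing.isLinear.Build R[i] H H *:%R (otimes_fun a b) (otimes_fun_linear a b).

Lemma otimes_fun_bounded a b :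
  exists M : R, forall x, `|otimes_fun a b x| <= M%:C * `|x|.
Proof.
exists (rnorm a * rnorm b) => x.
rewrite /rnorm rmorphM/= !RRe_real ?normr_real// normrZ mulrAC.
by rewrite ler_wpM2r// mulrC cauchy_schwarz.
Qed.

Definition otimes a b : bounded_operator :=
  BoundedOperator (otimes_fun_bounded a b).

Definition q_numerical_range q (A : bounded_operator) : set R[i] :=
  [set w | exists x y, [/\ rnorm x = 1, rnorm y = 1, '[x, y] = q%:C &
                           w = '[A x, y]]].

(* The supremum is taken in \bar R, so that asserting a finite value entails
   that the set is nonempty and bounded above. *)
Definition q_numerical_radius q (A : bounded_operator) : \bar R :=
  ereal_sup [set (rnorm w)%:E | w in q_numerical_range q A].

End Operators.

Notation "a '\otimes' b" := (otimes a b)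
  (at level 40, left associativity) : ring_scope.

(* Main.v *)
(* For unit vectors, [cosB q c] is [cos (alpha - beta)] when [q = cos alpha] and
   [c = cos beta], and the claim reads
   [max |<x, a>| |<y, b>| = (1 + cos (alpha - beta)) / 2].

   Upper bound, for the real inner product [Re <., .>].  Split
   [2 <x, a> <y, b>] into the symmetric part [<x, a> <y, b> + <x, b> <y, a>],
   which is at most [1 + <x, y> <a, b>] by Cauchy-Schwarz for the pairs
   [x + y, a + b] and [x - y, a - b], and the alternating part
   [<x, a> <y, b> - <x, b> <y, a>], which is at most the product of the areas
   of the parallelograms spanned by [x, y] and by [a, b].

   In the complex case, rotate phases so that [<x, a>], [<y, b>] and one of
   [<x, y>], [<a, b>] are nonnegative reals.  Passing to the real part then only
   decreases the other one, and since [cosB q] increases on [[-1, q]] this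
   costs nothing if that one was the smaller of the two moduli.

   The bound is attained by [x, y] in the real plane of the rotated [a, b], with
   the same bisector. *)

Require Import Defs.
From mathcomp Require Import all_boot all_order all_algebra.
From mathcomp Require Import complex.
From mathcomp Require Import all_classical all_reals.
From mathcomp Require Import ereal topology normedtype.
From mathcomp Require Import ring lra.

Set Implicit Arguments.
Unset Strict Implicit.
Unset Printing Implicit Defensive.

Import Order.TTheory GRing.Theory Num.Theory.
Local Open Scope ring_scope.

(** * Trigonometry of [cosB] without angles *)

Section RealAux.
Variable R : rcfType.
Implicit Types c d q : R.

Definition cosB q c : R :=
  q * c + Num.sqrt (1 - q ^+ 2) * Num.sqrt (1 - c ^+ 2).

Lemma cosBC q c : cosB q c = cosB c q.
Proof. by rewrite /cosB mulrC [X in _ + X]mulrC. Qed.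

(** For [q = cos alpha] the two roots on the right are the cosine and sine of [alpha / 2], and this
    is the double-angle formula for the sine. *)
Lemma sqrt_1B_sqr q : 0 <= q <= 1 ->
  Num.sqrt (1 - q ^+ 2) =
  2 * (Num.sqrt ((1 + q) / 2) * Num.sqrt ((1 - q) / 2)).
Proof.
move=> /andP[q0 q1].
rewrite -[RHS]ger0_norm ?mulr_ge0 ?sqrtr_ge0// -sqrtr_sqr; congr Num.sqrt.
by rewrite !exprMn !sqr_sqrtr; [field | lra | lra].
Qed.

(** The formula [2 cos^2 t = 1 + cos (2 t)] at [t = (alpha - beta) / 2]. *)
Lemma cosB_half_angle q c : 0 <= q <= 1 -> 0 <= c <= 1 ->
  2 * (Num.sqrt ((1 + q) / 2) * Num.sqrt ((1 + c) / 2) +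
       Num.sqrt ((1 - q) / 2) * Num.sqrt ((1 - c) / 2)) ^+ 2 = 1 + cosB q c.
Proof.
move=> q01 c01; rewrite /cosB !sqrt_1B_sqr//.
rewrite sqrrD !exprMn !sqr_sqrtr; [by field | lra | lra | lra | lra].
Qed.

(** As cosines of angles in [[0, pi]], [q], [c], [d] have increasing angles, so [d] lies further
    from [q] than [c] does. Bounding [|d|] also orders the sines of [c] and [d]. *)
Lemma cosB_le q c d : `|d| <= c -> c <= q -> q <= 1 -> cosB q d <= cosB q c.
Proof.
rewrite ler_norml => /andP[dc cd] cq q1; rewrite /cosB.
have S1 : Num.sqrt (1 - q ^+ 2) <= Num.sqrt (1 - c ^+ 2).
  by rewrite ler_wsqrtr//; nra.
have S2 : Num.sqrt (1 - c ^+ 2) <= Num.sqrt (1 - d ^+ 2).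
  by rewrite ler_wsqrtr//; nra.
have E1 : Num.sqrt (1 - d ^+ 2) ^+ 2 = 1 - d ^+ 2 by rewrite sqr_sqrtr//; nra.
have E2 : Num.sqrt (1 - c ^+ 2) ^+ 2 = 1 - c ^+ 2 by rewrite sqr_sqrtr//; nra.
have := sqrtr_ge0 (1 - q ^+ 2).
move: (Num.sqrt (1 - q ^+ 2)) (Num.sqrt (1 - c ^+ 2)) (Num.sqrt (1 - d ^+ 2))
  S1 S2 E1 E2 => s S S' sS SS' E1 E2 s0.
have [S'0|S'0] := eqVneq S' 0; first by nra.
have S'gt0 : 0 < S' by lra.
(* The factor [S' + S] turns the difference of roots into one of squares, from which [c - d] splits
   off. What remains follows from [q * (S' + S) >= 2 * q * s >= s * (c + d)]. *)
rewrite -subr_ge0 -(pmulr_rge0 _ (_ : 0 < S' + S)); last lra.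
have -> : (S' + S) * (q * c + s * S - (q * d + s * S')) =
  (c - d) * (q * (S' + S)) - s * (S' ^+ 2 - S ^+ 2) by ring.
rewrite E1 E2.
have -> : 1 - d ^+ 2 - (1 - c ^+ 2) = (c - d) * (c + d) by ring.
rewrite [s * _]mulrCA -mulrBr mulr_ge0//; first lra.
nra.
Qed.

End RealAux.

Lemma lin_indep_neq0 (K : fieldType) (V : lmodType K) n (f : 'I_n -> V) i :
  lin_indep f -> f i != 0.
Proof.
move=> f_indep; apply/eqP => fi0.
have /(_ _ i)/eqP := f_indep (fun j => (j == i)%:R).
rewrite eqxx oner_eq0 => /(_ _)/negP; apply => //.
rewrite big1// => j _; have [->|_] := eqVneq j i; first by rewrite fi0 scaler0.
by rewrite scale0r.
Qed.

(** * Real-valued norms and rules for the inner product *)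

Section InnerProduct.
Variables (R : realType) (H : hilbertType R).
Implicit Types (a b e x y z : H) (k : R) (u : R[i]).
Local Open Scope complex_scope.

Lemma rnormC (V : normedZmodType R[i]) (x : V) : (rnorm x)%:C = `|x|.
Proof. by rewrite /rnorm RRe_real// normr_real. Qed.

Lemma rnormM (z w : R[i]) : rnorm (z * w) = rnorm z * rnorm w.
Proof. by apply: (@complexI R); rewrite rmorphM/= !rnormC normrM. Qed.

Lemma rnormJ (z : R[i]) : rnorm (Num.conj z) = rnorm z.
Proof. by rewrite /rnorm norm_conjC. Qed.

Lemma rnorm_ge0 (V : normedZmodType R[i]) (x : V) : 0 <= rnorm x.
Proof. by rewrite -lecR rnormC normr_ge0. Qed.

Lemma Re_le_rnorm (z : R[i]) : `|complex.Re z| <= rnorm z.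
Proof. by rewrite -lecR rnormC normc_ge_Re. Qed.

Lemma rnorm_real k : rnorm k%:C = `|k|.
Proof. by rewrite /rnorm normc_def/= expr0n addr0 sqrtr_sqr. Qed.

Lemma rnormZ u x : rnorm (u *: x) = rnorm u * rnorm x.
Proof. by apply: (@complexI R); rewrite rmorphM/= !rnormC normrZ. Qed.

Lemma innerC x y : '[x, y] = Num.conj '[y, x].
Proof. by rewrite hermC/= mul1r. Qed.

Lemma rnorm_innerC x y : rnorm '[x, y] = rnorm '[y, x].
Proof. by rewrite innerC rnormJ. Qed.

Lemma innerxx x : '[x, x] = (rnorm x ^+ 2)%:C.
Proof. by rewrite inner_normE rmorphXn/= rnormC. Qed.

Lemma innerDl x y z : '[x + y, z] = '[x, z] + '[y, z].
Proof. exact: linearDl. Qed.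
Lemma innerDr x y z : '[z, x + y] = '[z, x] + '[z, y].
Proof. exact: linearDr. Qed.
Lemma innerBl x y z : '[x - y, z] = '[x, z] - '[y, z].
Proof. exact: linearBl. Qed.
Lemma innerBr x y z : '[z, x - y] = '[z, x] - '[z, y].
Proof. exact: linearBr. Qed.
Lemma innerNl x z : '[- x, z] = - '[x, z].
Proof. exact: linearNl. Qed.
Lemma innerZl u x z : '[u *: x, z] = u * '[x, z].
Proof. exact: linearZl_LR. Qed.
Lemma innerZr u x z : '[z, u *: x] = Num.conj u * '[z, x].
Proof. exact: linearZr_LR. Qed.
Lemma innerZrR k x z : '[z, k%:C *: x] = k%:C * '[z, x].
Proof. by rewrite innerZr; congr (_ * _); exact: conjc_real. Qed.

Lemma rnorm_inner_le x y : rnorm '[x, y] <= rnorm x * rnorm y.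
Proof. by rewrite -lecR rmorphM/= !rnormC cauchy_schwarz. Qed.

(** * The upper bound, first for the real part, then for moduli *)

Definition rinner x y : R := complex.Re '[x, y].

Lemma rinnerC x y : rinner x y = rinner y x.
Proof. by rewrite /rinner innerC; case: '[y, x]. Qed.
Lemma rinnerDl x y z : rinner (x + y) z = rinner x z + rinner y z.
Proof. by rewrite /rinner innerDl; case: '[x, z] => ? ?; case: '[y, z]. Qed.
Lemma rinnerZl k x z : rinner (k%:C *: x) z = k * rinner x z.
Proof.
by rewrite /rinner innerZl; case: '[x, z] => s t /=; rewrite mul0r subr0.
Qed.
Lemma rinnerNl x z : rinner (- x) z = - rinner x z.
Proof. by rewrite /rinner innerNl; case: '[x, z]. Qed.
Lemma rinnerDr x y z : rinner z (x + y) = rinner z x + rinner z y.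
Proof. by rewrite !(rinnerC z) rinnerDl. Qed.
Lemma rinnerZr k x z : rinner z (k%:C *: x) = k * rinner z x.
Proof. by rewrite !(rinnerC z) rinnerZl. Qed.
Lemma rinnerNr x z : rinner z (- x) = - rinner z x.
Proof. by rewrite !(rinnerC z) rinnerNl. Qed.
Definition rinnerE :=
  (rinnerDl, rinnerDr, rinnerNl, rinnerNr, rinnerZl, rinnerZr).

Lemma rinnerxx x : rinner x x = rnorm x ^+ 2.
Proof. by rewrite /rinner innerxx. Qed.

Lemma rinner_CS x y : rinner x y ^+ 2 <= rinner x x * rinner y y.
Proof.
rewrite !rinnerxx -exprMn -real_normK ?num_real//.
rewrite lerXn2r// ?nnegrE ?mulr_ge0 ?rnorm_ge0//.
exact: le_trans (Re_le_rnorm _) (rnorm_inner_le _ _).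
Qed.

Lemma rinner_prod_le x y a b :
  rnorm x = 1 -> rnorm y = 1 -> rnorm a = 1 -> rnorm b = 1 ->
  2 * (rinner x a * rinner y b) <= 1 + cosB (rinner x y) (rinner a b).
Proof.
move=> x1 y1 a1 b1.
have xx : rinner x x = 1 by rewrite rinnerxx x1 expr1n.
have yy : rinner y y = 1 by rewrite rinnerxx y1 expr1n.
have aa : rinner a a = 1 by rewrite rinnerxx a1 expr1n.
have bb : rinner b b = 1 by rewrite rinnerxx b1 expr1n.
have E1 := rinner_CS (x + y) (a + b).
have E2 := rinner_CS (x - y) (a - b).
(* With [c = <a, b>], [p = <x, a>], [t = <x, b>], E4 says that the Gram
   determinant of [x, a, b] is nonnegative, so that the vector
   [p b - t a] in E3 has squared norm at most [1 - c ^+ 2]. *)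
have E3 := rinner_CS (y - (rinner x y)%:C *: x)
             ((rinner x a)%:C *: b - (rinner x b)%:C *: a).
have E4 := rinner_CS (b - (rinner a b)%:C *: a) (x - (rinner x a)%:C *: a).
have Q2 := rinner_CS x y; have C2 := rinner_CS a b.
move: E1 E2 E3 E4 Q2 C2; rewrite /cosB !rinnerE.
rewrite (rinnerC y x) (rinnerC b a) (rinnerC a x) (rinnerC b x) xx yy aa bb.
move: (rinner x y) (rinner a b) (rinner x a) (rinner y b) (rinner x b)
  (rinner y a) => q c p r t k E1 E2 E3 E4 Q2 C2.
(* The sum of [E1] and [E2] is [(p + r)^2 + (t + k)^2 <= 4 (1 + q c)] up to a factor; the two
   squares added below turn sums into products. *)
have sym : p * r + t * k <= 1 + q * c.
  have := sqr_ge0 (p - r); have := sqr_ge0 (t - k); nra.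
suff alt : p * r - t * k <= Num.sqrt (1 - q ^+ 2) * Num.sqrt (1 - c ^+ 2).
  by lra.
rewrite -sqrtrM; last by lra.
apply: le_trans (ler_norm _) _.
rewrite -sqrtr_sqr ler_wsqrtr//.
(* The vector [p b - t a] is orthogonal to [x], so subtracting [q x] from [y] leaves their inner
   product equal to [p r - t k], while the squared norm of [y] drops to [1 - q ^+ 2]. *)
have E3' : (p * r - t * k) ^+ 2 <=
   (1 - q ^+ 2) * (p ^+ 2 - 2 * (p * t * c) + t ^+ 2).
  by apply: le_trans (le_trans _ E3) _; rewrite le_eqVlt; apply/orP; left;
    apply/eqP; ring.
apply: le_trans E3' _; apply: ler_wpM2l; first by lra.
by nra.
Qed.

Lemma unimodular_rotation (z : R[i]) :
  exists2 u : R[i], rnorm u = 1 & u * z = (rnorm z)%:C.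
Proof.
have [->|z0] := eqVneq z 0.
  exists 1; first by rewrite /rnorm normr1.
  by rewrite mulr0 rnormC normr0.
exists (`|z| / z); last by rewrite rnormC divfK.
by rewrite /rnorm normrM normfV normr_id divff ?normr_eq0.
Qed.

(** The phases of [x], [y], [a] are spent on making the other three inner products real and
    nonnegative. The phase of [<x, y>] is then out of control, and only its real part [d] enters the
    bound. *)
Lemma rnorm_inner_prod_le x y a b :
  rnorm x = 1 -> rnorm y = 1 -> rnorm a = 1 -> rnorm b = 1 ->
  exists2 d : R, `|d| <= rnorm '[x, y] &
    2 * (rnorm '[x, a] * rnorm '[y, b]) <= 1 + cosB (rnorm '[a, b]) d.
Proof.
move=> x1 y1 a1 b1.
have [w w1 wE] := unimodular_rotation '[a, b].
have [u u1 uE] := unimodular_rotation '[x, w *: a].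
have [v v1 vE] := unimodular_rotation '[y, b].
exists (rinner (u *: x) (v *: y)).
  apply: le_trans (Re_le_rnorm _) _.
  by rewrite innerZl innerZr !rnormM rnormJ u1 v1 !mul1r.
have xaE : rinner (u *: x) (w *: a) = rnorm '[x, a].
  by rewrite /rinner innerZl uE/= innerZr rnormM rnormJ w1 mul1r.
have ybE : rinner (v *: y) b = rnorm '[y, b] by rewrite /rinner innerZl vE.
have abE : rinner (w *: a) b = rnorm '[a, b] by rewrite /rinner innerZl wE.
have unit_scale t z : rnorm t = 1 -> rnorm z = 1 -> rnorm (t *: z) = 1.
  by move=> t1 z1; rewrite rnormZ t1 z1 mulr1.
rewrite cosBC -xaE -ybE -abE.
by apply: rinner_prod_le => //; exact: unit_scale.
Qed.

Lemma rnorm_inner_prod_le_cosB x y a b :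
  rnorm x = 1 -> rnorm y = 1 -> rnorm a = 1 -> rnorm b = 1 ->
  2 * (rnorm '[x, a] * rnorm '[y, b]) <=
  1 + cosB (rnorm '[x, y]) (rnorm '[a, b]).
Proof.
move=> x1 y1 a1 b1.
have inner_le1 z t : rnorm z = 1 -> rnorm t = 1 -> rnorm '[z, t] <= 1.
  by move=> z1 t1; have := rnorm_inner_le z t; rewrite z1 t1 mulr1.
(* The product is symmetric under exchanging [(x, y)] and [(a, b)], so the pair with the smaller
   modulus can be the one reduced to [d], as [cosB_le] requires. *)
have [qc|/ltW cq] := leP (rnorm '[x, y]) (rnorm '[a, b]).
  have [d dq /le_trans] := rnorm_inner_prod_le x1 y1 a1 b1; apply.
  by rewrite lerD2l [leRHS]cosBC cosB_le// inner_le1.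
have [d dc] := rnorm_inner_prod_le a1 b1 x1 y1.
rewrite (rnorm_innerC a x) (rnorm_innerC b y) => /le_trans; apply.
by rewrite lerD2l cosB_le// inner_le1.
Qed.

(** * Vectors attaining the bound *)

Lemma exists_unit_orthogonal (hdim : dim_geq H 2) z : rnorm z = 1 ->
  exists2 e, rnorm e = 1 & '[e, z] = 0.
Proof.
move=> z1; have [f f_indep] := hdim.
have zz : '[z, z] = 1 by rewrite innerxx z1 expr1n.
have [e e0 ez] : exists2 e, e != 0 & '[e, z] = 0.
  have proj_orth x : '[x - '[x, z] *: z, z] = 0.
    by rewrite innerBl innerZl zz mulr1 subrr.
  pose g i := f i - '[f i, z] *: z.
  have [g0|g0] := eqVneq (g ord0) 0; last first.
    by exists (g ord0) => //; exact: proj_orth.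
  have [g1|g1] := eqVneq (g ord_max) 0; last first.
    by exists (g ord_max) => //; exact: proj_orth.
  have fE0 : f ord0 = '[f ord0, z] *: z.
    by apply/eqP; rewrite -subr_eq0 -/(g _) g0.
  have fE1 : f ord_max = '[f ord_max, z] *: z.
    by apply/eqP; rewrite -subr_eq0 -/(g _) g1.
  (* If both projections vanish, these coefficients give a linear relation; independence then kills
     ['[f ord0, z]], hence [f ord0] itself. *)
  pose c (i : 'I_2) := if i == ord0 then '[f ord_max, z] else - '[f ord0, z].
  have /(_ _ ord_max) := f_indep c.
  rewrite /c/= => /(_ _)/eqP; rewrite oppr_eq0 => /(_ _)/eqP fz0.
  exfalso; have /eqP := lin_indep_neq0 ord0 f_indep; apply.
  rewrite fE0 fz0 ?scale0r//.
  rewrite !big_ord_recl big_ord0/= addr0.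
  have -> : lift ord0 ord0 = ord_max :> 'I_2 by apply/val_inj.
  apply/eqP; rewrite scaleNr subr_eq0; apply/eqP.
  by rewrite {1}fE0 scalerA mulrC -scalerA -fE1.
exists (`|e|^-1 *: e); last by rewrite innerZl ez mulr0.
by rewrite /rnorm normrZ normfV normr_id mulVf// normr_eq0.
Qed.

Lemma exists_unit (hdim : dim_geq H 2) : exists e, rnorm e = 1.
Proof.
have [f f_indep] := hdim.
exists (`|f ord0|^-1 *: f ord0).
by rewrite /rnorm normrZ normfV normr_id mulVf// normr_eq0 lin_indep_neq0.
Qed.

Lemma inner_orthonormal e f (m n k l : R) :
  rnorm e = 1 -> rnorm f = 1 -> '[e, f] = 0 ->
  '[m%:C *: e + n%:C *: f, k%:C *: e + l%:C *: f] = (m * k + n * l)%:C.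
Proof.
move=> e1 f1 ef.
have fe : '[f, e] = 0 by rewrite innerC ef rmorph0.
rewrite !(innerDl, innerDr, innerZl, innerZrR) ef fe !innerxx e1 f1 !expr1n.
by rewrite !(mulr0, mulr1, addr0, add0r) rmorphD/= !rmorphM.
Qed.

Lemma rnorm_eq1 x : '[x, x] = 1 -> rnorm x = 1.
Proof.
rewrite innerxx => /(@complexI R _ 1)/eqP.
by rewrite sqrp_eq1 ?rnorm_ge0// => /eqP.
Qed.

Lemma bisecting_frame (hdim : dim_geq H 2) a b c :
  rnorm a = 1 -> rnorm b = 1 -> '[a, b] = c%:C -> 0 <= c <= 1 ->
  exists e f, [/\ rnorm e = 1, rnorm f = 1, '[e, f] = 0,
    a = (Num.sqrt ((1 + c) / 2))%:C *: e + (Num.sqrt ((1 - c) / 2))%:C *: f &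
    b = (Num.sqrt ((1 + c) / 2))%:C *: e + (- Num.sqrt ((1 - c) / 2))%:C *: f].
Proof.
move=> a1 b1 ab.
have ba : '[b, a] = c%:C by rewrite innerC ab; exact: conjc_real.
move=> /andP[c0]; rewrite le_eqVlt => /predU1P[c1|c1].
  (* Here [a - b] gives no direction for [f], which must come from the dimension hypothesis. *)
  have -> : a = b.
    apply/eqP; rewrite -subr_eq0 -normr_eq0 -sqrf_eq0 -inner_normE.
    rewrite !(innerBl, innerBr) ba ab !innerxx a1 b1 c1 expr1n.
    by rewrite !subrr.
  have [f f1 fb] := exists_unit_orthogonal hdim b1.
  exists b, f; split=> //; first by rewrite innerC fb rmorph0.
  - by rewrite c1 subrr mul0r sqrtr0 scale0r addr0 divff ?sqrtr1 ?scale1r.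
  - by rewrite c1 subrr mul0r sqrtr0 oppr0 scale0r addr0 divff ?sqrtr1 ?scale1r.
set k := Num.sqrt ((1 + c) / 2); set l := Num.sqrt ((1 - c) / 2).
have k0 : 0 < k by rewrite sqrtr_gt0; lra.
have l0 : 0 < l by rewrite sqrtr_gt0; lra.
have kE : k ^+ 2 = (1 + c) / 2 by rewrite sqr_sqrtr//; lra.
have lE : l ^+ 2 = (1 - c) / 2 by rewrite sqr_sqrtr//; lra.
(* The norms of [a + b] and [a - b] are [2 * k] and [2 * l]; the two vectors are orthogonal because
   ['[a, b]] is real. *)
exists ((2 * k)^-1%:C *: (a + b)), ((2 * l)^-1%:C *: (a - b)); split.
- apply: rnorm_eq1; rewrite innerZl innerZrR !(innerDl, innerDr) ab ba.
  rewrite !innerxx a1 b1 -!rmorphD -!rmorphM/=.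
  suff -> : (2 * k)^-1 * ((2 * k)^-1 * (1 ^+ 2 + c + (c + 1 ^+ 2))) = 1 by [].
  have -> : 1 ^+ 2 + c + (c + 1 ^+ 2) = 4 * k ^+ 2 by rewrite kE; field.
  by field; lra.
- apply: rnorm_eq1; rewrite innerZl innerZrR !(innerBl, innerBr) ab ba.
  rewrite !innerxx a1 b1 -!rmorphB -!rmorphM/=.
  suff -> : (2 * l)^-1 * ((2 * l)^-1 * (1 ^+ 2 - c - (c - 1 ^+ 2))) = 1 by [].
  have -> : 1 ^+ 2 - c - (c - 1 ^+ 2) = 4 * l ^+ 2 by rewrite lE; field.
  by field; lra.
- rewrite innerZl innerZrR !(innerDl, innerBr) ab ba !innerxx a1 b1.
  by ring.
- rewrite !scalerA -!rmorphM/=.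
  have -> : k * (2 * k)^-1 = 2^-1 by field; lra.
  have -> : l * (2 * l)^-1 = 2^-1 by field; lra.
  rewrite -scalerDr addrACA subrr addr0 -mulr2n -scaler_nat scalerA.
  by rewrite -(rmorph_nat (real_complex R)) -rmorphM/= mulVf ?scale1r.
- rewrite !scalerA -!rmorphM/=.
  have -> : k * (2 * k)^-1 = 2^-1 by field; lra.
  have -> : - l * (2 * l)^-1 = - 2^-1 by field; lra.
  rewrite rmorphN/= scaleNr -scalerBr opprB (addrC a) addrACA subrr addr0.
  rewrite -mulr2n -scaler_nat scalerA.
  by rewrite -(rmorph_nat (real_complex R)) -rmorphM/= mulVf ?scale1r.
Qed.

Lemma cosB_attained (hdim : dim_geq H 2) a b q :
  rnorm a = 1 -> rnorm b = 1 -> 0 <= q <= 1 ->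
  exists x y, [/\ rnorm x = 1, rnorm y = 1, '[x, y] = q%:C &
    2 * (rnorm '[x, a] * rnorm '[y, b]) = 1 + cosB q (rnorm '[a, b])].
Proof.
move=> a1 b1 q01; have [q0 q1] := andP q01.
have [u u1 uE] := unimodular_rotation '[a, b].
have ua1 : rnorm (u *: a) = 1 by rewrite rnormZ u1 a1 mulr1.
have c01 : 0 <= rnorm '[a, b] <= 1.
  by rewrite rnorm_ge0/=; have := rnorm_inner_le a b; rewrite a1 b1 mulr1.
have uab : '[u *: a, b] = (rnorm '[a, b])%:C by rewrite innerZl.
have [e [f [e1 f1 ef aE bE]]] := bisecting_frame hdim ua1 b1 uab c01.
have xa x : rnorm '[x, a] = rnorm '[x, u *: a].
  by rewrite innerZr rnormM rnormJ u1 mul1r.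
(* In the frame [e, f], the rotated [a] and [b] have angles [beta / 2] and [- beta / 2]. Taking [x]
   and [y] at [alpha / 2] and [- alpha / 2] makes both inner products equal to
   [cos ((alpha - beta) / 2)]. *)
exists ((Num.sqrt ((1 + q) / 2))%:C *: e + (Num.sqrt ((1 - q) / 2))%:C *: f).
exists ((Num.sqrt ((1 + q) / 2))%:C *: e + (- Num.sqrt ((1 - q) / 2))%:C *: f).
have mE : Num.sqrt ((1 + q) / 2) * Num.sqrt ((1 + q) / 2) = (1 + q) / 2.
  by rewrite -expr2 sqr_sqrtr//; lra.
have nE : Num.sqrt ((1 - q) / 2) * Num.sqrt ((1 - q) / 2) = (1 - q) / 2.
  by rewrite -expr2 sqr_sqrtr//; lra.
split.
- apply: rnorm_eq1; rewrite inner_orthonormal// mE nE.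
  by rewrite (_ : _ + _ = 1) ?rmorph1//; field.
- apply: rnorm_eq1; rewrite inner_orthonormal// mulrNN mE nE.
  by rewrite (_ : _ + _ = 1) ?rmorph1//; field.
- rewrite inner_orthonormal// mulrN mE nE.
  by rewrite (_ : _ - _ = q)//; field.
rewrite xa [X in '[_, X]]aE [X in _ * rnorm '[_, X]]bE !inner_orthonormal//.
rewrite !rnorm_real mulrNN -normrM -expr2 ger0_norm ?sqr_ge0//.
exact: cosB_half_angle.
Qed.

(** An arbitrary unit vector serves when [a = 0], so the reduction to unit vectors needs no separate
    zero case. *)
Lemma unit_multiple (hdim : dim_geq H 2) a :
  exists2 e, rnorm e = 1 & a = (rnorm a)%:C *: e.
Proof.
have [->|a0] := eqVneq a 0.
  have [e e1] := exists_unit hdim; exists e => //.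
  by rewrite rnormC normr0 scale0r.
exists (`|a|^-1 *: a).
  by rewrite /rnorm normrZ normfV normr_id mulVf// normr_eq0.
by rewrite rnormC scalerA divff ?scale1r// normr_eq0.
Qed.

End InnerProduct.

Theorem theorem2p1 (R : realType) (H : hilbertType R) (hdim : dim_geq H 2)
  (a b : H) (q : R) (hq : 0 <= q <= 1) :
  q_numerical_radius q (a \otimes b) =
  ((rnorm a * rnorm b + q * rnorm '[a, b]) / 2
   + Num.sqrt (1 - q ^+ 2) / 2
     * Num.sqrt (rnorm a ^+ 2 * rnorm b ^+ 2 - rnorm '[a, b] ^+ 2))%:E.
Proof.
have [a' a1 aE] := unit_multiple hdim a.
have [b' b1 bE] := unit_multiple hdim b.
have a0 := rnorm_ge0 a; have b0 := rnorm_ge0 b.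
have rescale x y : rnorm '[(a \otimes b) x, y] =
    rnorm a * rnorm b / 2 * (2 * (rnorm '[x, a'] * rnorm '[y, b'])).
  rewrite /= /otimes_fun innerZl rnormM (rnorm_innerC b y) {1}aE {1}bE.
  rewrite !innerZrR !rnormM !rnorm_real !ger0_norm//.
  by field.
have -> : (rnorm a * rnorm b + q * rnorm '[a, b]) / 2
   + Num.sqrt (1 - q ^+ 2) / 2
     * Num.sqrt (rnorm a ^+ 2 * rnorm b ^+ 2 - rnorm '[a, b] ^+ 2) =
   rnorm a * rnorm b / 2 * (1 + cosB q (rnorm '[a', b'])).
  have -> : rnorm '[a, b] = rnorm a * rnorm b * rnorm '[a', b'].
    rewrite {1}aE {1}bE innerZl innerZrR !rnormM !rnorm_real !ger0_norm//.
    by rewrite mulrA.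
  set c := rnorm '[a', b']; rewrite /cosB.
  have -> : rnorm a ^+ 2 * rnorm b ^+ 2 - (rnorm a * rnorm b * c) ^+ 2 =
    (rnorm a * rnorm b) ^+ 2 * (1 - c ^+ 2) by ring.
  rewrite sqrtrM ?sqr_ge0// sqrtr_sqr ger0_norm ?mulr_ge0//.
  by field.
apply/eqP; rewrite eq_le; apply/andP; split.
  apply: ge_ereal_sup => _ [_ [x [y [x1 y1 xy ->]]] <-].
  rewrite lee_fin rescale ler_wpM2l ?divr_ge0 ?mulr_ge0//.
  (* The bound is stated with moduli; [q] is its own modulus since [0 <= q]. *)
  have -> : q = rnorm '[x, y].
    by rewrite xy rnorm_real ger0_norm//; case/andP: hq.
  exact: rnorm_inner_prod_le_cosB.
have [x [y [x1 y1 xy xyE]]] := cosB_attained hdim a1 b1 hq.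
apply: ereal_sup_ubound; exists '[(a \otimes b) x, y].
  by exists x, y.
by rewrite rescale xyE.
Qed.
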